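(* Suppose that $\dot s(r)\le 0$ for $r\in[0,R]$, that $q\neq 0$, and that $\frac{1}{\alpha}\max_{0\le r\le R}s(r)$ is sufficiently small. Then there exists a constant $c$ such that any solution $v$ of the initial-boundary-value problem $$(1+q\beta)\,v_r+\alpha^2 q\,v_{zzr}=\mathrm{i}\,\lambda\,(\alpha^2 v_{zz}+\beta v)\quad\text{in }\mathcal D,$$ $$v(0,z)=v_0(z)\ \ (0\le z\le s(0)),\qquad v(r,0)=0,\quad v(r,s(r))=0\ \ (0\le r\le R),$$ satisfies $$\|v(r,\cdot)\|_2\le c\,\|v_0\|_2,\qquad 0\le r\le R .$$
   Context: Here $R>0$, $\alpha>0$ (the reciprocal of a reference wave number), $p,q$ are complex constants, $\lambda=\frac{p-q}{\alpha}$, $s$ is a smooth positive function on $[0,R]$ with $\dot s=ds/dr$, $\mathcal{D}=\{(r,z)\in\mathbb{R}^2:\ 0\le z\le s(r),\ 0\le r\le R\}$, and $\beta=\beta(r,z)$ is a complex-valued function on $\mathcal D$. The unknown $v=v(r,z)$ is complex-valued on $\mathcal D$, $v_0$ is a given complex-valued function on $[0,s(0)]$, and subscripts $r,z$ denote partial derivatives. The functions $v$, $\beta$, $s$, $v_0$ are assumed sufficiently smooth. The norms are range-dependent norms on $[0,s(r)]$: $\|v\|=\big(\int_0^{s(r)}|v(r,z)|^2dz\big)^{1/2}$, $\|v\|_1=(\|v\|^2+\|v_z\|^2)^{1/2}$, $\|v\|_2=(\|v\|_1^2+\|v_{zz}\|^2)^{1/2}$; $\|v_0\|_2$ is the corresponding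 norm on $[0,s(0)]$. *)

(* Defs.v *)
From Stdlib Require Import Reals.
From Coquelicot Require Import Coquelicot.

Open Scope R_scope.

(** A C^k function on a closed set [D] is represented by a total function that
    is of class C^k on some open set containing [D], so that derivatives at
    boundary points of [D] are two-sided ones.  For the sets [D] used below
    their values do not depend on the chosen extension of the function. *)

Fixpoint Ck_on_open_1d (k : nat) (U : R -> Prop) (f : R -> R) : Prop :=
  match k with
  | O => forall x, U x -> continuous f x
  | S k' =>
      (forall x, U x -> continuous f x /\ ex_derive f x) /\
      Ck_on_open_1d k' U (Derive f)
  end.

Fixpoint Ck_on_open_2d (k : nat) (U : R * R -> Prop) (f : R -> R -> R) : Prop :=
  match k with
  | O => forall r z, U (r, z) ->
           continuous (fun x : R * R => f (fst x) (snd x)) (r, z)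
  | S k' =>
      (forall r z, U (r, z) ->
         continuous (fun x : R * R => f (fst x) (snd x)) (r, z) /\
         ex_derive (fun x => f x z) r /\
         ex_derive (fun y => f r y) z) /\
      Ck_on_open_2d k' U (fun r z => Derive (fun x => f x z) r) /\
      Ck_on_open_2d k' U (fun r z => Derive (fun y => f r y) z)
  end.

Definition Ck_1d (k : nat) (a b : R) (f : R -> R) : Prop :=
  exists U : R -> Prop,
    open U /\ (forall x, a <= x <= b -> U x) /\ Ck_on_open_1d k U f.

Definition Ck_2d (k : nat) (D : R * R -> Prop) (f : R -> R -> R) : Prop :=
  exists U : R * R -> Prop,
    open U /\ (forall x, D x -> U x) /\ Ck_on_open_2d k U f.

Definition Ck_cplx_1d (k : nat) (a b : R) (f : R -> C) : Prop :=
  Ck_1d k a b (fun x => Re (f x)) /\ Ck_1d k a b (fun x => Im (f x)).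

Definition Ck_cplx_2d (k : nat) (D : R * R -> Prop) (f : R -> R -> C) : Prop :=
  Ck_2d k D (fun r z => Re (f r z)) /\ Ck_2d k D (fun r z => Im (f r z)).

Definition DeriveC (f : R -> C) (x : R) : C :=
  (Derive (fun t => Re (f t)) x, Derive (fun t => Im (f t)) x).

Definition d_r (v : R -> R -> C) (r z : R) : C := DeriveC (fun x => v x z) r.
Definition d_z (v : R -> R -> C) (r z : R) : C := DeriveC (fun y => v r y) z.

Definition is_max_on (f : R -> R) (a b m : R) : Prop :=
  (exists x, a <= x <= b /\ f x = m) /\ (forall x, a <= x <= b -> f x <= m).

Definition waveguide (rmax : R) (s : R -> R) : R * R -> Prop :=
  fun x => 0 <= snd x <= s (fst x) /\ 0 <= fst x <= rmax.

Definition norm_L2 (l : R) (f : R -> C) : R :=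
  sqrt (RInt (fun z => Cmod (f z) ^ 2) 0 l).
Definition norm_1 (l : R) (f : R -> C) : R :=
  sqrt (norm_L2 l f ^ 2 + norm_L2 l (DeriveC f) ^ 2).
Definition norm_2 (l : R) (f : R -> C) : R :=
  sqrt (norm_1 l f ^ 2 + norm_L2 l (DeriveC (DeriveC f)) ^ 2).

Definition lambda (alpha : R) (p q : C) : C := ((p - q) / RtoC alpha)%C.

Definition solves_ibvp (rmax alpha : R) (p q : C) (s : R -> R)
    (beta : R -> R -> C) (v0 : R -> C) (v : R -> R -> C) : Prop :=
  (forall r z, waveguide rmax s (r, z) ->
     ((1 + q * beta r z) * d_r v r z
        + RtoC (alpha ^ 2) * q * d_r (d_z (d_z v)) r z
      = Ci * lambda alpha p q
          * (RtoC (alpha ^ 2) * d_z (d_z v) r z + beta r z * v r z))%C) /\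
  (forall z, 0 <= z <= s 0 -> v 0 z = v0 z) /\
  (forall r, 0 <= r <= rmax -> v r 0 = RtoC 0) /\
  (forall r, 0 <= r <= rmax -> v r (s r) = RtoC 0).

(* Main.v *)
Require Import Defs.
From Stdlib Require Import Reals Lra Classical IndefiniteDescription.
From Coquelicot Require Import Coquelicot.

(** At fixed [r], [w = v_r] solves
    [alpha^2 q w_zz + (1 + q beta) w = i lambda (alpha^2 v_zz + beta v)] with [w = 0] at [z = 0]
    and, by differentiating [v(r, s(r)) = 0], [w = - s' v_z] at [z = s(r)].
    If [s / alpha] is small the term in [w] can be absorbed, so that [w], and hence
    [v_zzr = w_zz], is controlled by [v_zz].  By Leibniz' rule
    [d/dr int_0^s |v_zz|^2 = s' |v_zz(r, s)|^2 + 2 Re int_0^s conj(v_zz) v_zzr], whose first term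
    is nonpositive because [s' <= 0].  Gronwall's lemma bounds [||v_zz||], and the lower-order
    parts of the norm follow because [v] vanishes at both ends. *)

Open Scope R_scope.

(** * Calculus on open subsets of the plane *)

Definition D_r (f : R -> R -> R) (r z : R) : R := Derive (fun x => f x z) r.
Definition D_z (f : R -> R -> R) (r z : R) : R := Derive (fun y => f r y) z.

Lemma Ck_on_open_2d_weaken (k : nat) (U : R * R -> Prop) (f : R -> R -> R) :
  Ck_on_open_2d (S k) U f -> Ck_on_open_2d k U f.
Proof.
  revert f; induction k as [|k IH]; intros f [H [H1 H2]].
  - intros r z Hrz; apply (H r z Hrz).
  - split; [exact H|split; [apply IH, H1|apply IH, H2]].
Qed.

Lemma Ck_on_open_2d_subset (k : nat) (U V : R * R -> Prop) (f : R -> R -> R) :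
  (forall x, V x -> U x) -> Ck_on_open_2d k U f -> Ck_on_open_2d k V f.
Proof.
  intros HVU; revert f; induction k as [|k IH]; intros f Hf.
  - intros r z Hrz; apply Hf, HVU, Hrz.
  - destruct Hf as [H [H1 H2]].
    split; [intros r z Hrz; apply H, HVU, Hrz|split; [apply IH, H1|apply IH, H2]].
Qed.

Lemma Ck_on_open_2d_continuous (k : nat) (U : R * R -> Prop) (f : R -> R -> R) (r z : R) :
  Ck_on_open_2d k U f -> U (r, z) ->
  continuous (fun x : R * R => f (fst x) (snd x)) (r, z).
Proof.
  destruct k as [|k]; [intros H Hrz; apply H, Hrz|].
  intros [H _] Hrz; apply (H r z Hrz).
Qed.

Lemma continuous_comp_2d (f : R -> R -> R) (g h : R -> R) (x : R) :
  continuous (fun u : R * R => f (fst u) (snd u)) (g x, h x) ->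
  continuous g x -> continuous h x -> continuous (fun t => f (g t) (h t)) x.
Proof. intros Hf Hg Hh; exact (continuous_comp_2 g h f x Hg Hh Hf). Qed.

Lemma Ck_on_open_2d_continuous_snd (k : nat) (U : R * R -> Prop) (f : R -> R -> R) (r z : R) :
  Ck_on_open_2d k U f -> U (r, z) -> continuous (f r) z.
Proof.
  intros Hf Hrz; apply (continuous_comp_2d f (fun _ => r) (fun t => t)).
  - exact (Ck_on_open_2d_continuous k U f r z Hf Hrz).
  - apply continuous_const.
  - apply continuous_id.
Qed.

Lemma Ck_on_open_2d_is_derive_fst (k : nat) (U : R * R -> Prop) (f : R -> R -> R) (r z : R) :
  Ck_on_open_2d (S k) U f -> U (r, z) -> is_derive (fun x => f x z) r (D_r f r z).
Proof. intros [H _] Hrz; apply Derive_correct, (H r z Hrz). Qed.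

Lemma Ck_on_open_2d_is_derive_snd (k : nat) (U : R * R -> Prop) (f : R -> R -> R) (r z : R) :
  Ck_on_open_2d (S k) U f -> U (r, z) -> is_derive (f r) z (D_z f r z).
Proof. intros [H _] Hrz; apply Derive_correct, (H r z Hrz). Qed.

Lemma open_locally_snd (U : R * R -> Prop) (r z : R) :
  open U -> U (r, z) -> locally z (fun y => U (r, y)).
Proof.
  intros HU Hrz; destruct (HU _ Hrz) as [e He]; exists e; intros y Hy.
  apply He; split; [apply ball_center|exact Hy].
Qed.

Lemma D_r_D_z_comm (U : R * R -> Prop) (f : R -> R -> R) (r z : R) :
  open U -> Ck_on_open_2d 2 U f -> U (r, z) -> D_r (D_z f) r z = D_z (D_r f) r z.
Proof.
  intros HU [H [[H1 [H11 H12]] [H2 [H21 H22]]]] Hrz.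
  apply (Schwarz f r z).
  - apply locally_2d_locally.
    generalize (HU _ Hrz); apply filter_imp; intros [x y] Hxy; simpl.
    destruct (H x y Hxy) as [_ [Ha Hb]]; destruct (H1 x y Hxy) as [_ [_ Hc]].
    destruct (H2 x y Hxy) as [_ [Hd _]]; repeat split; assumption.
  - apply continuity_2d_pt_filterlim, (H21 r z Hrz).
  - apply continuity_2d_pt_filterlim, (H12 r z Hrz).
Qed.

(** Schwarz' theorem is applied twice: to [D_z f] at the point itself, and to [f] under the outer
    [z]-derivative. The second use needs equality at all nearby [z], which openness of [U]
    supplies. *)
Lemma D_z_D_z_D_r (U : R * R -> Prop) (f : R -> R -> R) (r z : R) :
  open U -> Ck_on_open_2d 3 U f -> U (r, z) ->
  D_z (D_z (D_r f)) r z = D_r (D_z (D_z f)) r z.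
Proof.
  intros HU Hf Hrz.
  rewrite (D_r_D_z_comm U (D_z f)); [|assumption|apply Hf|assumption].
  unfold D_z at 1 3; apply Derive_ext_loc.
  generalize (open_locally_snd U r z HU Hrz); apply filter_imp; intros y Hy.
  symmetry; apply (D_r_D_z_comm U); [assumption| |assumption].
  apply Ck_on_open_2d_weaken, Hf.
Qed.

(** Both partial derivatives exist and [D_r f] is continuous, so [f] is totally differentiable at
    [(r, s r)]. The chain rule along [x -> (x, s x)] then applies. *)
Lemma is_derive_along_graph (U : R * R -> Prop) (f : R -> R -> R) (s : R -> R) (r ds : R) :
  open U -> Ck_on_open_2d 1 U f -> U (r, s r) -> is_derive s r ds ->
  is_derive (fun x => f x (s x)) r (D_r f r (s r) + ds * D_z f r (s r)).
Proof.
  intros HU Hf Hr Hs.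
  assert (Hd : filterdiff (fun u : R * R => f (fst u) (snd u)) (locally (r, s r))
     (fun u : R * R => plus (scal (fst u) (D_r f r (s r))) (scal (snd u) (D_z f r (s r))))).
  { apply (is_derive_filterdiff f r (s r) (D_r f)).
    - generalize (HU _ Hr); apply filter_imp; intros [x y] Hxy.
      exact (Ck_on_open_2d_is_derive_fst 0 U f x y Hf Hxy).
    - exact (Ck_on_open_2d_is_derive_snd 0 U f r (s r) Hf Hr).
    - apply (Ck_on_open_2d_continuous 0 U); [apply Hf|assumption]. }
  apply filterdiff_ext_lin with
    (fun y : R => plus (scal y (D_r f r (s r))) (scal (scal y ds) (D_z f r (s r)))).
  - apply (filterdiff_comp'_2 (fun x => x) s f r (fun y => y) (fun y => scal y ds)
      (fun a b => plus (scal a (D_r f r (s r))) (scal b (D_z f r (s r))))).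
    + apply filterdiff_id.
    + exact Hs.
    + exact Hd.
  - intros y; unfold plus, scal; simpl; unfold mult; simpl; ring.
Qed.

(** Compactness of the vertical segment: the radii of balls around its points that lie in [U] can be
    bounded below uniformly. *)
Lemma tube_neighborhood (U : R * R -> Prop) (r a b : R) :
  a <= b -> open U -> (forall z, a <= z <= b -> U (r, z)) ->
  exists e : posreal, forall x z,
    Rabs (x - r) < e -> a - e <= z <= b + e -> U (x, z).
Proof.
  intros Hab HU Hseg.
  (* The radius 1 off the segment is a placeholder, so that choice yields a gauge on the whole
     line. *)
  assert (Hex : forall t, exists d : posreal, a <= t <= b ->
    forall x z, Rabs (x - r) < d -> Rabs (z - t) < d -> U (x, z)).
  { intros t; destruct (classic (a <= t <= b)) as [Ht|Ht].
    - destruct (HU _ (Hseg t Ht)) as [d Hd]; exists d; intros _ x z Hx Hz.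
      apply Hd; split; assumption.
    - exists (mkposreal 1 Rlt_0_1); intros H; contradiction. }
  set (d t := proj1_sig (constructive_indefinite_description _ (Hex t))).
  assert (Hd : forall t, a <= t <= b ->
    forall x z, Rabs (x - r) < d t -> Rabs (z - t) < d t -> U (x, z)).
  { intros t; exact (proj2_sig (constructive_indefinite_description _ (Hex t))). }
  (* Half the radius is spent on the distance from [y] to [t]; the other half absorbs the distance
     from [z] to [y]. *)
  set (hd t := mkposreal (d t / 2) (is_pos_div_2 (d t))).
  destruct (compactness_value_1d a b hd) as [e He].
  exists (mkposreal (e / 2) (is_pos_div_2 e)); simpl; intros x z Hx Hz.
  assert (He0 := cond_pos e).
  (* [y] is the point of the segment closest to [z] *)
  set (y := Rmax a (Rmin b z)).
  assert (Hy : a <= y <= b /\ Rabs (z - y) <= e / 2).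
  { unfold y; split.
    - split; [apply Rmax_l|apply Rmax_lub; [assumption|apply Rmin_l]].
    - unfold Rmax, Rmin; destruct (Rle_dec b z); destruct (Rle_dec a _);
        apply Rabs_le; lra. }
  destruct Hy as [Hy Hzy].
  destruct (NNPP _ (He y Hy)) as [t [Ht [Hyt Het]]]; simpl in Hyt, Het.
  apply (Hd t Ht); [lra|].
  replace (z - t) with ((z - y) + (y - t)) by ring.
  apply (Rle_lt_trans _ _ _ (Rabs_triang _ _)); lra.
Qed.

(** * Differentiation of an integral with a moving upper end *)

Lemma ex_RInt_cont (f : R -> R) (a b : R) :
  a <= b -> (forall z, a <= z <= b -> continuous f z) -> ex_RInt f a b.
Proof.
  intros Hab Hf; apply (ex_RInt_continuous (V := R_CompleteNormedModule)).
  rewrite Rmin_left, Rmax_right by assumption; exact Hf.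
Qed.

(** Leibniz' rule. The tube around the segment at [r] provides integrability and differentiability
    of the integrand on one common neighbourhood, slightly beyond the end [s r]. *)
Lemma is_derive_RInt_moving_end (U : R * R -> Prop) (F dF : R -> R -> R)
    (s : R -> R) (r ds : R) :
  open U -> (forall z, 0 <= z <= s r -> U (r, z)) -> 0 < s r ->
  (forall x z, U (x, z) -> continuous (fun u : R * R => F (fst u) (snd u)) (x, z)) ->
  (forall x z, U (x, z) -> is_derive (fun t => F t z) x (dF x z)) ->
  (forall x z, U (x, z) -> continuous (fun u : R * R => dF (fst u) (snd u)) (x, z)) ->
  is_derive s r ds ->
  is_derive (fun x => RInt (F x) 0 (s x)) r (RInt (dF r) 0 (s r) + F r (s r) * ds).
Proof.
  intros HU Hseg Hl HF HD HdF Hs.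
  destruct (tube_neighborhood U r 0 (s r) (Rlt_le _ _ Hl) HU Hseg) as [e He].
  assert (HFz : forall x z, U (x, z) -> continuous (F x) z).
  { intros x z Hxz; apply (continuous_comp_2d F (fun _ => x) (fun t => t)).
    - exact (HF x z Hxz).
    - apply continuous_const.
    - apply continuous_id. }
  assert (Hc : forall x z, U (x, z) ->
    continuity_2d_pt (fun u v => Derive (fun t => F t v) u) x z).
  { intros x z Hxz; apply continuity_2d_pt_filterlim.
    apply (filterlim_ext_loc (fun u : R * R => dF (fst u) (snd u))).
    - generalize (HU _ Hxz); apply filter_imp; intros [x' z'] H'.
      symmetry; apply is_derive_unique, HD, H'.
    - replace (Derive (fun t : R => F t z) x) with (dF x z)
        by (symmetry; apply is_derive_unique, HD, Hxz).
      apply (HdF x z Hxz). }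
  assert (Hball : locally r (fun x => Rabs (x - r) < e)).
  { exists e; intros y Hy; exact Hy. }
  assert (He0 := cond_pos e).
  (* The half-width [Rmin e (s r)] keeps the interval around the moving end inside the tube and in
     [z >= 0]. *)
  assert (Hm1 := Rmin_l e (s r)); assert (Hm2 := Rmin_r e (s r)).
  assert (Hm := Rmin_glb_lt _ _ _ He0 Hl).
  replace (RInt (dF r) 0 (s r)) with (RInt (fun t => Derive (fun u => F u t) r) 0 (s r)).
  2:{ apply RInt_ext; intros z Hz; apply is_derive_unique, HD, Hseg.
      rewrite Rmin_left, Rmax_right in Hz; lra. }
  apply (is_derive_RInt_param_bound_comp_aux3 F 0 s r ds).
  - revert Hball; apply filter_imp; intros x Hx; apply ex_RInt_cont; [lra|].
    intros z Hz; apply HFz, He; lra.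
  - exists (mkposreal _ Hm); simpl.
    revert Hball; apply filter_imp; intros x Hx; apply ex_RInt_cont; [lra|].
    intros z Hz; apply HFz, He; lra.
  - exact Hs.
  - exists (mkposreal _ Hm); simpl.
    revert Hball; apply filter_imp; intros x Hx t Ht.
    rewrite Rmin_left, Rmax_right in Ht by lra.
    eexists; apply HD, He; lra.
  - rewrite Rmin_left, Rmax_right by lra; intros t Ht; apply Hc, Hseg, Ht.
  - apply locally_2d_locally.
    assert (Hr : U (r, s r)) by (apply Hseg; lra).
    generalize (HU _ Hr); apply filter_imp; intros [x y] Hxy; apply Hc, Hxy.
  - apply continuity_pt_filterlim, HFz, Hseg; lra.
Qed.

(** * Real functions on an interval *)

(** The increment is the integral of [g1] between the two points, and since [P] is nonnegative its
    integral may be enlarged to all of [[0, l]]. A general majorant [P] lets the modulus of a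
    complex function serve for both of its components. *)
Lemma increment_le_RInt (g g1 P : R -> R) (l x y : R) :
  (forall z, 0 <= z <= l -> is_derive g z (g1 z)) ->
  (forall z, 0 <= z <= l -> continuous g1 z) ->
  (forall z, 0 <= z <= l -> continuous P z) ->
  (forall z, 0 <= z <= l -> Rabs (g1 z) <= P z) ->
  0 <= x <= l -> 0 <= y <= l -> Rabs (g x - g y) <= RInt P 0 l.
Proof.
  intros Hg Hg1 HP Hle.
  assert (Hex : forall a b, 0 <= a -> a <= b -> b <= l -> ex_RInt P a b).
  { intros a b Ha Hab Hb; apply ex_RInt_cont; [assumption|].
    intros z Hz; apply HP; lra. }
  assert (HP0 : forall z, 0 <= z <= l -> 0 <= P z).
  { intros z Hz; apply (Rle_trans _ (Rabs (g1 z))); [apply Rabs_pos|apply Hle, Hz]. }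
  assert (Hpos : forall a b, 0 <= a -> a <= b -> b <= l -> 0 <= RInt P a b).
  { intros a b Ha Hab Hb; apply RInt_ge_0; [assumption|apply Hex; lra|].
    intros z Hz; apply HP0; lra. }
  assert (Hmain : forall a b, 0 <= a -> a <= b -> b <= l ->
    Rabs (g b - g a) <= RInt P 0 l).
  { intros a b Ha Hab Hb.
    assert (Hi : is_RInt g1 a b (g b - g a)).
    { apply (is_RInt_derive (V := R_CompleteNormedModule) g g1);
        rewrite Rmin_left, Rmax_right by lra; intros z Hz;
        [apply Hg|apply Hg1]; lra. }
    assert (E1 := RInt_Chasles P 0 a l (Hex 0 a ltac:(lra) Ha ltac:(lra))
                    (Hex a l Ha ltac:(lra) ltac:(lra))).
    assert (E2 := RInt_Chasles P a b l (Hex a b ltac:(lra) Hab ltac:(lra))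
                    (Hex b l ltac:(lra) ltac:(lra) ltac:(lra))).
    unfold plus in E1, E2; simpl in E1, E2.
    assert (Q1 := Hpos 0 a ltac:(lra) Ha ltac:(lra)).
    assert (Q2 := Hpos b l ltac:(lra) Hb ltac:(lra)).
    apply (Rle_trans _ (RInt P a b)); [|lra].
    apply (norm_RInt_le (V := R_NormedModule) g1 P a b); [assumption| |exact Hi|].
    - intros z Hz; apply Hle; lra.
    - apply (RInt_correct (V := R_CompleteNormedModule)), Hex; lra. }
  intros Hx Hy; destruct (Rle_dec x y) as [Hxy|Hxy].
  - rewrite Rabs_minus_sym; apply Hmain; lra.
  - apply Hmain; lra.
Qed.

(** Since [g 0 = 0], the mean value theorem gives a point where [g1] equals [g l / l]; elsewhere
    [g1] differs from this value by at most the integral of [P]. A second use, [g z = g1 x * z],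
    passes the bound on to [g]. *)
Lemma bounds_of_zero_at_left_end (g g1 g2 P : R -> R) (l : R) :
  0 < l -> g 0 = 0 ->
  (forall z, 0 <= z <= l -> is_derive g z (g1 z)) ->
  (forall z, 0 <= z <= l -> is_derive g1 z (g2 z)) ->
  (forall z, 0 <= z <= l -> continuous g2 z) ->
  (forall z, 0 <= z <= l -> continuous P z) ->
  (forall z, 0 <= z <= l -> Rabs (g2 z) <= P z) ->
  forall z, 0 <= z <= l ->
    Rabs (g1 z) <= Rabs (g l) / l + RInt P 0 l /\
    Rabs (g z) <= Rabs (g l) + l * RInt P 0 l.
Proof.
  intros Hl H0 Hg Hg1 Hg2 HP Hle.
  assert (Hmvt : forall z, 0 <= z <= l -> exists c, 0 <= c <= l /\ g z = g1 c * z).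
  { intros z Hz; destruct (MVT_gen g 0 z g1) as [c [Hc E]].
    - rewrite Rmin_left, Rmax_right by lra; intros x Hx; apply Hg; lra.
    - rewrite Rmin_left, Rmax_right by lra; intros x Hx.
      apply continuity_pt_filterlim.
      apply (ex_derive_continuous (V := R_NormedModule) g).
      exists (g1 x); apply Hg; lra.
    - rewrite Rmin_left, Rmax_right in Hc by lra.
      exists c; split; lra. }
  destruct (Hmvt l) as [c [Hc Ec]]; [lra|].
  assert (Hg1b : forall z, 0 <= z <= l -> Rabs (g1 z) <= Rabs (g l) / l + RInt P 0 l).
  { intros z Hz.
    assert (Hi := increment_le_RInt g1 g2 P l z c Hg1 Hg2 HP Hle Hz Hc).
    replace (Rabs (g l) / l) with (Rabs (g1 c)).
    - replace (g1 z) with (g1 c + (g1 z - g1 c)) by ring.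
      apply (Rle_trans _ _ _ (Rabs_triang _ _)); lra.
    - rewrite Ec, Rabs_mult, (Rabs_right l) by lra; field; lra. }
  intros z Hz; split; [apply Hg1b, Hz|].
  destruct (Hmvt z Hz) as [x [Hx Ex]].
  rewrite Ex, Rabs_mult, (Rabs_right z) by lra.
  assert (Hb := Hg1b x Hx).
  replace (Rabs (g l) + l * RInt P 0 l) with ((Rabs (g l) / l + RInt P 0 l) * l)
    by (field; lra).
  apply Rmult_le_compat; [apply Rabs_pos|lra|assumption|lra].
Qed.

(** Cauchy-Schwarz against the constant 1, obtained by integrating [(f z - m) ^ 2 >= 0] with [m] the
    mean of [f]. *)
Lemma RInt_sqr_le (f : R -> R) (l : R) :
  0 < l -> (forall z, 0 <= z <= l -> continuous f z) ->
  RInt f 0 l ^ 2 <= l * RInt (fun z => f z ^ 2) 0 l.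
Proof.
  intros Hl Hf.
  set (m := RInt f 0 l / l).
  assert (Hf2 : forall z, 0 <= z <= l -> continuous (fun z => f z ^ 2) z).
  { intros z Hz; apply (continuous_ext (fun z => mult (f z) (f z))).
    - intros x; unfold mult; simpl; ring.
    - apply (continuous_mult (K := R_AbsRing)); apply Hf, Hz. }
  assert (E1 : ex_RInt f 0 l) by (apply ex_RInt_cont; [lra|exact Hf]).
  assert (E2 : ex_RInt (fun z => f z ^ 2) 0 l) by (apply ex_RInt_cont; [lra|exact Hf2]).
  assert (Hi : is_RInt (fun z => (f z - m) ^ 2) 0 l
     (RInt (fun z => f z ^ 2) 0 l + (- 2 * m * RInt f 0 l + (l - 0) * m ^ 2))).
  { apply (is_RInt_ext (fun z => plus (f z ^ 2) (plus (scal (- 2 * m) (f z)) (m ^ 2)))).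
    - intros z _; unfold plus, scal; simpl; unfold mult; simpl; ring.
    - apply (is_RInt_plus (V := R_NormedModule)).
      + exact (RInt_correct _ _ _ E2).
      + apply (is_RInt_plus (V := R_NormedModule)).
        * apply (is_RInt_scal (V := R_NormedModule)), (RInt_correct _ _ _ E1).
        * apply (is_RInt_const (V := R_NormedModule)). }
  assert (Hpos := is_RInt_ge_0 _ 0 l _ (Rlt_le _ _ Hl) Hi
     (fun z _ => pow2_ge_0 (f z - m))).
  assert (Em : m * l = RInt f 0 l) by (unfold m; field; lra).
  rewrite <- Em in Hpos |- *; nra.
Qed.

(** The function [E r * exp (- K * r)] does not increase, by the mean value theorem. The inequality
    is asked only at interior points: the boundary conditions hold for [r] in a closed interval, and
    can be differentiated in [r] only inside it. *)
Lemma gronwall (E dE : R -> R) (K T : R) :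
  (forall r, 0 <= r <= T -> is_derive E r (dE r)) ->
  (forall r, 0 < r < T -> dE r <= K * E r) ->
  forall r, 0 <= r <= T -> E r <= E 0 * exp (K * r).
Proof.
  intros HE HdE r Hr.
  set (h := fun x => E x * exp (- K * x)).
  assert (Hh : forall x, 0 <= x <= T ->
    is_derive h x (dE x * exp (- K * x) + E x * (- K * exp (- K * x)))).
  { intros x Hx; apply (is_derive_mult E (fun x => exp (- K * x))).
    - apply HE, Hx.
    - auto_derive; [exact I|ring].
    - intros; apply Rmult_comm. }
  assert (Hdec : h r <= h 0).
  { destruct (Req_dec r 0) as [->|Hr0]; [lra|].
    destruct (MVT_cor2 h (fun x => dE x * exp (- K * x) + E x * (- K * exp (- K * x))) 0 r)
      as [c [Ec Hc]]; [lra| |].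
    - intros x Hx; apply is_derive_Reals, Hh; lra.
    - assert (H1 := HdE c ltac:(lra)); assert (H2 := exp_pos (- K * c)).
      assert (H3 : 0 <= (K * E c - dE c) * exp (- K * c) * r).
      { apply Rmult_le_pos; [apply Rmult_le_pos|]; lra. }
      lra. }
  unfold h in Hdec; replace (- K * 0) with 0 in Hdec by ring; rewrite exp_0 in Hdec.
  replace (E r) with (E r * exp (- K * r) * exp (K * r)).
  - apply Rmult_le_compat_r; [apply Rlt_le, exp_pos|lra].
  - rewrite Rmult_assoc, <- exp_plus; replace (- K * r + K * r) with 0 by ring.
    rewrite exp_0; ring.
Qed.

(** * Complex-valued functions on an interval *)

Definition is_deriveC (f : R -> C) (z : R) (d : C) : Prop :=
  is_derive (fun t => Re (f t)) z (Re d) /\ is_derive (fun t => Im (f t)) z (Im d).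

Definition continuousC (f : R -> C) (z : R) : Prop :=
  continuous (fun t => Re (f t)) z /\ continuous (fun t => Im (f t)) z.

(** Derivatives are two-sided also at [0] and [l], as the smooth extension to an open set
    provides. *)
Definition C2_jet (l : R) (f f1 f2 : R -> C) : Prop :=
  forall z, 0 <= z <= l ->
    is_deriveC f z (f1 z) /\ is_deriveC f1 z (f2 z) /\ continuousC f2 z.

(** * Moduli and pointwise bounds from second derivatives *)

Lemma im_le_Cmod (c : C) : Rabs (Im c) <= Cmod c.
Proof. apply (Rle_trans _ _ _ (Rmax_r _ _) (Rmax_Cmod c)). Qed.

Lemma Cmod_le_Rabs_plus (c : C) : Cmod c <= Rabs (Re c) + Rabs (Im c).
Proof.
  assert (H1 := Rabs_pos (Re c)); assert (H2 := Rabs_pos (Im c)).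
  apply Rsqr_incr_0_var; [|lra].
  assert (H := Cmod2_alt c); unfold Rsqr.
  rewrite <- (pow2_abs (Re c)), <- (pow2_abs (Im c)) in H; nra.
Qed.

(** The left side is the real part of [Cconj x * y]. *)
Lemma Re_conj_mult_le (x y : C) : Re x * Re y + Im x * Im y <= Cmod x * Cmod y.
Proof.
  rewrite <- (Cmod_conj x), <- Cmod_mult.
  apply (Rle_trans _ (Rabs (Re (Cconj x * y)%C))); [|apply re_le_Cmod].
  apply (Rle_trans _ (Re (Cconj x * y)%C)); [|apply Rle_abs].
  right; unfold Re, Im, Cconj, Cmult; simpl; ring.
Qed.

Lemma continuous_Cmod (f : R -> C) (z : R) :
  continuousC f z -> continuous (fun t => Cmod (f t)) z.
Proof.
  intros [H1 H2]; apply (continuous_comp (fun t => fst (f t) ^ 2 + snd (f t) ^ 2) sqrt).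
  - apply (continuous_plus (V := R_NormedModule)); simpl;
      apply (continuous_mult (K := R_AbsRing)); try assumption;
      apply (continuous_mult (K := R_AbsRing)); try assumption; apply continuous_const.
  - apply continuity_pt_filterlim, continuity_pt_sqrt.
    assert (Ha := pow2_ge_0 (fst (f z))); assert (Hb := pow2_ge_0 (snd (f z))); lra.
Qed.

Lemma continuous_sqr (f : R -> R) (z : R) :
  continuous f z -> continuous (fun t => f t ^ 2) z.
Proof.
  intros H; apply (continuous_ext (fun z => mult (f z) (f z))).
  - intros x; unfold mult; simpl; ring.
  - apply (continuous_mult (K := R_AbsRing)); exact H.
Qed.

Lemma is_deriveC_continuousC (f : R -> C) (z : R) (d : C) :
  is_deriveC f z d -> continuousC f z.
Proof.
  intros [H1 H2]; split;
    apply (ex_derive_continuous (K := R_AbsRing) (V := R_NormedModule)); eexists; eassumption.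
Qed.

(** The real estimate is applied to both components; adding them costs the factor 2. *)
Lemma C2_jet_bounds (f f1 f2 : R -> C) (P : R -> R) (l : R) :
  0 < l -> f 0 = RtoC 0 -> C2_jet l f f1 f2 ->
  (forall z, 0 <= z <= l -> continuous P z) ->
  (forall z, 0 <= z <= l -> Cmod (f2 z) <= P z) ->
  forall z, 0 <= z <= l ->
    Cmod (f1 z) <= 2 * (Cmod (f l) / l + RInt P 0 l) /\
    Cmod (f z) <= 2 * (Cmod (f l) + l * RInt P 0 l).
Proof.
  intros Hl H0 Hf HP Hle z Hz.
  destruct (bounds_of_zero_at_left_end (fun t => Re (f t)) (fun t => Re (f1 t))
    (fun t => Re (f2 t)) P l Hl) with (z := z) as [R1 R2]; try assumption.
  { now rewrite H0. }
  1-3: intros x Hx; apply (Hf x Hx).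
  { intros x Hx; apply (Rle_trans _ _ _ (re_le_Cmod _) (Hle x Hx)). }
  destruct (bounds_of_zero_at_left_end (fun t => Im (f t)) (fun t => Im (f1 t))
    (fun t => Im (f2 t)) P l Hl) with (z := z) as [I1 I2]; try assumption.
  { now rewrite H0. }
  1-3: intros x Hx; apply (Hf x Hx).
  { intros x Hx; apply (Rle_trans _ _ _ (im_le_Cmod _) (Hle x Hx)). }
  assert (Ha := re_le_Cmod (f l)); assert (Hb := im_le_Cmod (f l)).
  assert (Hil := Rinv_0_lt_compat _ Hl).
  assert (Ha' := Rmult_le_compat_r _ _ _ (Rlt_le _ _ Hil) Ha).
  assert (Hb' := Rmult_le_compat_r _ _ _ (Rlt_le _ _ Hil) Hb).
  unfold Rdiv in *.
  split; apply (Rle_trans _ _ _ (Cmod_le_Rabs_plus _)); lra.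
Qed.

(** The boundary terms vanish with [v l], so the integral of [Cmod (v2 z)] alone controls [v1] and
    [v]. Replacing [l] by [m] makes the constants uniform over the ranges [r]. *)
Lemma C2_jet_dirichlet_bounds (v v1 v2 : R -> C) (l m : R) :
  0 < l <= m -> C2_jet l v v1 v2 -> v 0 = RtoC 0 -> v l = RtoC 0 ->
  0 <= RInt (fun z => Cmod (v2 z)) 0 l /\
  forall z, 0 <= z <= l ->
    Cmod (v1 z) <= 2 * RInt (fun z => Cmod (v2 z)) 0 l /\
    Cmod (v z) <= 2 * m * RInt (fun z => Cmod (v2 z)) 0 l.
Proof.
  intros Hl Hv H0 Hvl.
  assert (Hc : forall z, 0 <= z <= l -> continuous (fun z => Cmod (v2 z)) z).
  { intros z Hz; apply continuous_Cmod, (Hv z Hz). }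
  assert (HI : 0 <= RInt (fun z => Cmod (v2 z)) 0 l).
  { apply RInt_ge_0; [lra|apply ex_RInt_cont; [lra|exact Hc]|].
    intros; apply Cmod_ge_0. }
  split; [exact HI|]; intros z Hz.
  destruct (C2_jet_bounds v v1 v2 (fun z => Cmod (v2 z)) l) with (z := z) as [B1 B2];
    try assumption; try lra.
  { intros; apply Rle_refl. }
  rewrite Hvl, Cmod_0 in B1, B2.
  set (I := RInt (fun z => Cmod (v2 z)) 0 l) in *.
  split; [unfold Rdiv in B1; lra|].
  assert (l * I <= m * I) by (apply Rmult_le_compat_r; lra); lra.
Qed.

(* Smallness of [m ^ 2 * k] lets the zeroth-order term [k * Cmod (w z)] be absorbed. *)
Lemma helmholtz_second_derivative_bound (v v1 v2 w w1 w2 : R -> C) (l m S k L N : R) :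
  0 < l <= m -> 0 <= S -> 0 <= k -> 0 <= L -> 0 <= N -> 4 * m ^ 2 * k <= 1 ->
  C2_jet l v v1 v2 -> C2_jet l w w1 w2 ->
  v 0 = RtoC 0 -> v l = RtoC 0 -> w 0 = RtoC 0 ->
  Cmod (w l) <= S * Cmod (v1 l) ->
  (forall z, 0 <= z <= l ->
     Cmod (w2 z) <= k * Cmod (w z) + L * Cmod (v2 z) + N * Cmod (v z)) ->
  forall z, 0 <= z <= l ->
    Cmod (w2 z) <= L * Cmod (v2 z)
      + (k * (8 * S + 4 * m * L + 8 * N * m ^ 3) + 2 * N * m)
        * RInt (fun z => Cmod (v2 z)) 0 l.
Proof.
  intros Hl HS Hk HL HN Hsmall Hv Hw Hv0 Hvl Hw0 Hwl Heq.
  destruct (C2_jet_dirichlet_bounds v v1 v2 l m Hl Hv Hv0 Hvl) as [HI Hvb].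
  assert (Hc : forall z, 0 <= z <= l -> continuous (fun z => Cmod (v2 z)) z).
  { intros z Hz; apply continuous_Cmod, (Hv z Hz). }
  assert (Hex : ex_RInt (fun z => Cmod (v2 z)) 0 l) by (apply ex_RInt_cont; [lra|exact Hc]).
  set (I := RInt (fun z => Cmod (v2 z)) 0 l) in *.
  (* With [W] the attained maximum of [Cmod (w z)], the pointwise inequality for [w2] gets the
     constant [B], and the resulting bound on [w] at [z0] is an inequality for the single number
     [W]. *)
  destruct (continuity_ab_maj (fun z => Cmod (w z)) 0 l) as [z0 [Hmax Hz0]]; [lra| |].
  { intros z Hz; apply continuity_pt_filterlim, continuous_Cmod.
    apply (is_deriveC_continuousC _ _ _ (proj1 (Hw z Hz))). }
  set (W := Cmod (w z0)) in *.
  assert (HW0 : 0 <= W) by apply Cmod_ge_0.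
  set (B := k * W + N * (2 * m * I)).
  assert (Hw2 : forall z, 0 <= z <= l -> Cmod (w2 z) <= B + L * Cmod (v2 z)).
  { intros z Hz; apply (Rle_trans _ _ _ (Heq z Hz)); unfold B.
    assert (H1 := Rmult_le_compat_l _ _ _ Hk (Hmax z Hz)).
    assert (H2 := Rmult_le_compat_l _ _ _ HN (proj2 (Hvb z Hz))); lra. }
  assert (Hint : is_RInt (fun z => B + L * Cmod (v2 z)) 0 l ((l - 0) * B + L * I)).
  { apply (is_RInt_plus (V := R_NormedModule)).
    - apply (is_RInt_const (V := R_NormedModule)).
    - apply (is_RInt_scal (V := R_NormedModule)), (RInt_correct _ _ _ Hex). }
  assert (HWb : W <= 2 * (Cmod (w l) + l * ((l - 0) * B + L * I))).
  { rewrite <- (is_RInt_unique _ _ _ _ Hint).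
    apply (C2_jet_bounds w w1 w2 (fun z => B + L * Cmod (v2 z)) l);
      try assumption; try lra.
    intros z Hz; apply (continuous_plus (V := R_NormedModule)); [apply continuous_const|].
    apply (continuous_scal_r (V := R_NormedModule) L), Hc, Hz. }
  assert (Hwl' : Cmod (w l) <= S * (2 * I)).
  { apply (Rle_trans _ _ _ Hwl), Rmult_le_compat_l; [assumption|apply Hvb; lra]. }
  assert (HB : 0 <= B).
  { unfold B; assert (0 <= k * W) by (apply Rmult_le_pos; lra).
    assert (0 <= N * (2 * m * I)) by (repeat apply Rmult_le_pos; lra); lra. }
  assert (HLI : 0 <= L * I) by (apply Rmult_le_pos; assumption).
  assert (HWb2 : W <= 4 * (S * I) + 2 * (m * (m * B + L * I))).
  { assert (l * ((l - 0) * B + L * I) <= m * (m * B + L * I)); [|lra].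
    assert (l * B <= m * B) by (apply Rmult_le_compat_r; lra).
    assert (0 <= l * B) by (apply Rmult_le_pos; lra).
    apply Rmult_le_compat; lra. }
  (* The term [2 * m ^ 2 * k * W] is at most [W / 2] by smallness; moving it to the left doubles the
     remaining coefficients. *)
  assert (HWb3 : W <= (8 * S + 4 * m * L + 8 * N * m ^ 3) * I).
  { assert (4 * m ^ 2 * k * W <= 1 * W) by (apply Rmult_le_compat_r; assumption).
    unfold B in HWb2; lra. }
  intros z Hz; apply (Rle_trans _ _ _ (Hw2 z Hz)); unfold B.
  assert (H1 := Rmult_le_compat_l _ _ _ Hk HWb3); lra.
Qed.

(** The integrand is at most [2 * Cmod (v2 z) * Cmod (w2 z)]. After inserting the bound on [w2], the
    nonlocal term gives the square of the integral of [Cmod (v2 z)], which Cauchy-Schwarz bounds by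
    [m] times the energy. *)
Lemma energy_rate_le (v2 w2 : R -> C) (l m L c : R) :
  0 < l <= m -> 0 <= c ->
  (forall z, 0 <= z <= l -> continuousC v2 z) ->
  (forall z, 0 <= z <= l -> continuousC w2 z) ->
  (forall z, 0 <= z <= l ->
     Cmod (w2 z) <= L * Cmod (v2 z) + c * RInt (fun z => Cmod (v2 z)) 0 l) ->
  RInt (fun z => 2 * (Re (v2 z) * Re (w2 z) + Im (v2 z) * Im (w2 z))) 0 l
    <= (2 * L + 2 * c * m) * RInt (fun z => Cmod (v2 z) ^ 2) 0 l.
Proof.
  intros Hl Hc Hv Hw Hle.
  assert (Hcv : forall z, 0 <= z <= l -> continuous (fun z => Cmod (v2 z)) z).
  { intros z Hz; apply continuous_Cmod, (Hv z Hz). }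
  assert (Hex1 : ex_RInt (fun z => Cmod (v2 z)) 0 l) by (apply ex_RInt_cont; [lra|exact Hcv]).
  assert (Hex2 : ex_RInt (fun z => Cmod (v2 z) ^ 2) 0 l).
  { apply ex_RInt_cont; [lra|]; intros z Hz; apply continuous_sqr, Hcv, Hz. }
  assert (HCS := RInt_sqr_le (fun z : R => Cmod (v2 z)) l (proj1 Hl) Hcv); cbv beta in HCS.
  assert (HE : 0 <= RInt (fun z => Cmod (v2 z) ^ 2) 0 l).
  { apply RInt_ge_0; [lra|exact Hex2|intros; apply pow2_ge_0]. }
  set (I := RInt (fun z => Cmod (v2 z)) 0 l) in *.
  set (E := RInt (fun z => Cmod (v2 z) ^ 2) 0 l) in *.
  assert (Hint : is_RInt (fun z => 2 * L * Cmod (v2 z) ^ 2 + 2 * c * I * Cmod (v2 z)) 0 l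
    (2 * L * E + 2 * c * I * I)).
  { apply (is_RInt_plus (V := R_NormedModule));
      apply (is_RInt_scal (V := R_NormedModule)), (RInt_correct (V := R_CompleteNormedModule));
      assumption. }
  apply (Rle_trans _ (2 * L * E + 2 * c * I * I)).
  - rewrite <- (is_RInt_unique _ _ _ _ Hint).
    apply RInt_le; [lra| |eexists; exact Hint|].
    + apply ex_RInt_cont; [lra|]; intros z Hz.
      destruct (Hv z Hz) as [A1 A2]; destruct (Hw z Hz) as [B1 B2].
      apply (continuous_scal_r (V := R_NormedModule) 2).
      apply (continuous_plus (V := R_NormedModule));
        apply (continuous_mult (K := R_AbsRing)); assumption.
    + intros z Hz; assert (H1 := Re_conj_mult_le (v2 z) (w2 z)).
      assert (H2 := Rmult_le_compat_l _ _ _ (Cmod_ge_0 (v2 z)) (Hle z ltac:(lra))).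
      lra.
  - assert (l * E <= m * E) by (apply Rmult_le_compat_r; lra).
    assert (c * (I ^ 2) <= c * (m * E)) by (apply Rmult_le_compat_l; lra); lra.
Qed.

(** * The norms of order zero and two *)

Lemma norm_L2_sqr (l : R) (f : R -> C) :
  0 <= l -> (forall z, 0 <= z <= l -> continuousC f z) ->
  norm_L2 l f ^ 2 = RInt (fun z => Cmod (f z) ^ 2) 0 l.
Proof.
  intros Hl Hf; unfold norm_L2; rewrite <- Rsqr_pow2; apply Rsqr_sqrt.
  apply RInt_ge_0; [assumption| |intros; apply pow2_ge_0].
  apply ex_RInt_cont; [assumption|]; intros z Hz; apply continuous_sqr, continuous_Cmod, Hf, Hz.
Qed.

Lemma norm_L2_sqr_le (l B : R) (f : R -> C) :
  0 <= l -> (forall z, 0 <= z <= l -> continuousC f z) ->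
  (forall z, 0 <= z <= l -> Cmod (f z) <= B) ->
  norm_L2 l f ^ 2 <= l * B ^ 2.
Proof.
  intros Hl Hf HB; rewrite norm_L2_sqr by assumption.
  replace (l * B ^ 2) with (RInt (fun _ => B ^ 2) 0 l).
  - apply RInt_le; [assumption| |apply ex_RInt_const|].
    + apply ex_RInt_cont; [assumption|].
      intros z Hz; apply continuous_sqr, continuous_Cmod, Hf, Hz.
    + intros z Hz; apply pow_incr; split; [apply Cmod_ge_0|apply HB; lra].
  - rewrite RInt_const; unfold scal; simpl; unfold mult; simpl; ring.
Qed.

Lemma norm_2_sqr (l : R) (f : R -> C) :
  norm_2 l f ^ 2
  = norm_L2 l f ^ 2 + norm_L2 l (DeriveC f) ^ 2 + norm_L2 l (DeriveC (DeriveC f)) ^ 2.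
Proof.
  unfold norm_2, norm_1.
  assert (H0 := pow2_ge_0 (norm_L2 l f)); assert (H1 := pow2_ge_0 (norm_L2 l (DeriveC f))).
  assert (H2 := pow2_ge_0 (norm_L2 l (DeriveC (DeriveC f)))).
  rewrite pow2_sqrt, pow2_sqrt; rewrite ?pow2_sqrt; lra.
Qed.

(** The uniform bounds [2 * m * I] on [f] and [2 * I] on its derivative are squared and integrated,
    and [I ^ 2 <= l * E] by Cauchy-Schwarz; this gives the terms [4 * m ^ 4] and [4 * m ^ 2]. *)
Lemma norm_2_sqr_le_of_dirichlet (l m : R) (f : R -> C) :
  0 < l <= m -> C2_jet l f (DeriveC f) (DeriveC (DeriveC f)) ->
  f 0 = RtoC 0 -> f l = RtoC 0 ->
  norm_2 l f ^ 2 <= (1 + 4 * m ^ 2 + 4 * m ^ 4) * norm_L2 l (DeriveC (DeriveC f)) ^ 2.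
Proof.
  intros Hl Hf H0 Hfl.
  destruct (C2_jet_dirichlet_bounds _ _ _ l m Hl Hf H0 Hfl) as [HI Hb].
  assert (HCS := RInt_sqr_le (fun z => Cmod (DeriveC (DeriveC f) z)) l (proj1 Hl)
    (fun z Hz => continuous_Cmod _ _ (proj2 (proj2 (Hf z Hz))))).
  cbv beta in HCS.
  rewrite <- norm_L2_sqr in HCS; [|lra|intros z Hz; apply (Hf z Hz)].
  rewrite norm_2_sqr.
  set (I := RInt (fun z => Cmod (DeriveC (DeriveC f) z)) 0 l) in *.
  set (E := norm_L2 l (DeriveC (DeriveC f)) ^ 2) in *.
  assert (HE : 0 <= E) by apply pow2_ge_0.
  assert (B0 : norm_L2 l f ^ 2 <= l * (2 * m * I) ^ 2).
  { apply norm_L2_sqr_le; [lra| |intros; now apply Hb].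
    intros z Hz; apply (is_deriveC_continuousC _ _ _ (proj1 (Hf z Hz))). }
  assert (B1 : norm_L2 l (DeriveC f) ^ 2 <= l * (2 * I) ^ 2).
  { apply norm_L2_sqr_le; [lra| |intros; now apply Hb].
    intros z Hz; apply (is_deriveC_continuousC _ _ _ (proj1 (proj2 (Hf z Hz)))). }
  assert (HI2 : l * I ^ 2 <= m ^ 2 * E).
  { apply (Rle_trans _ (l * (l * E))); [apply Rmult_le_compat_l; lra|].
    replace (l * (l * E)) with (l ^ 2 * E) by ring.
    apply Rmult_le_compat_r; [assumption|apply pow_incr; lra]. }
  assert (Hm2 := pow2_ge_0 m).
  assert (m ^ 2 * (l * I ^ 2) <= m ^ 2 * (m ^ 2 * E)) by (apply Rmult_le_compat_l; lra).
  lra.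
Qed.

(** * The initial-boundary-value problem *)

Definition CkC_on_open_2d (k : nat) (U : R * R -> Prop) (v : R -> R -> C) : Prop :=
  Ck_on_open_2d k U (fun r z => Re (v r z)) /\ Ck_on_open_2d k U (fun r z => Im (v r z)).

Lemma CkC_on_open_2d_C2_jet (U : R * R -> Prop) (v : R -> R -> C) (r l : R) :
  CkC_on_open_2d 2 U v -> (forall z, 0 <= z <= l -> U (r, z)) ->
  C2_jet l (v r) (d_z v r) (d_z (d_z v) r).
Proof.
  intros [Ha Hb] HU z Hz; specialize (HU z Hz).
  split; [|split]; split.
  - exact (Ck_on_open_2d_is_derive_snd 1 U _ r z Ha HU).
  - exact (Ck_on_open_2d_is_derive_snd 1 U _ r z Hb HU).
  - exact (Ck_on_open_2d_is_derive_snd 0 U _ r z (proj2 (proj2 Ha)) HU).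
  - exact (Ck_on_open_2d_is_derive_snd 0 U _ r z (proj2 (proj2 Hb)) HU).
  - exact (Ck_on_open_2d_continuous_snd 0 U _ r z (proj2 (proj2 (proj2 (proj2 Ha)))) HU).
  - exact (Ck_on_open_2d_continuous_snd 0 U _ r z (proj2 (proj2 (proj2 (proj2 Hb)))) HU).
Qed.

Lemma d_z_d_z_d_r (U : R * R -> Prop) (v : R -> R -> C) (r z : R) :
  open U -> CkC_on_open_2d 3 U v -> U (r, z) ->
  d_z (d_z (d_r v)) r z = d_r (d_z (d_z v)) r z.
Proof.
  intros HU [Ha Hb] Hz; apply injective_projections.
  - exact (D_z_D_z_D_r U _ r z HU Ha Hz).
  - exact (D_z_D_z_D_r U _ r z HU Hb Hz).
Qed.

(** * Boundary values of [v_r], the bound from the equation, and the energy identity *)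

Lemma Derive_zero_loc (f : R -> R) (a b r : R) :
  a < r < b -> (forall x, a <= x <= b -> f x = 0) -> Derive f r = 0.
Proof.
  intros Hr Hf; rewrite (Derive_ext_loc f (fun _ => 0)); [apply Derive_const|].
  apply (locally_interval _ r a b); [apply Hr|apply Hr|].
  simpl; intros y Hy1 Hy2; apply Hf; lra.
Qed.

Lemma d_r_zero_on_line (v : R -> R -> C) (a b r z : R) :
  a < r < b -> (forall x, a <= x <= b -> v x z = RtoC 0) -> d_r v r z = RtoC 0.
Proof.
  intros Hr Hv; unfold d_r, DeriveC; rewrite !(Derive_zero_loc _ a b) by
    (try assumption; intros x Hx; now rewrite Hv).
  reflexivity.
Qed.

(** The function [v x (s x)] vanishes near [r], so its total derivative [v_r + s' v_z] is zero
    there. *)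
Lemma d_r_zero_along_graph (U : R * R -> Prop) (v : R -> R -> C) (s : R -> R) (a b r : R) :
  open U -> CkC_on_open_2d 1 U v -> U (r, s r) -> ex_derive s r ->
  a < r < b -> (forall x, a <= x <= b -> v x (s x) = RtoC 0) ->
  d_r v r (s r) = (RtoC (- Derive s r) * d_z v r (s r))%C.
Proof.
  intros HU [Ha Hb] Hr Hs Hab Hv; apply Derive_correct in Hs.
  assert (Ea := is_derive_unique _ _ _ (is_derive_along_graph U _ s r _ HU Ha Hr Hs)).
  assert (Eb := is_derive_unique _ _ _ (is_derive_along_graph U _ s r _ HU Hb Hr Hs)).
  rewrite (Derive_zero_loc _ a b) in Ea by (try assumption; intros x Hx; now rewrite Hv).
  rewrite (Derive_zero_loc _ a b) in Eb by (try assumption; intros x Hx; now rewrite Hv).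
  unfold D_r, D_z in Ea, Eb.
  apply injective_projections; unfold d_r, d_z, DeriveC; simpl; lra.
Qed.

(** The equation is solved for [X], which plays the role of [v_zzr], and moduli are taken. The
    coefficient of [Cmod w] scales like [1 / alpha ^ 2], which is why the depth must be small
    relative to [alpha]. *)
Lemma equation_bound (q lam b w X Y v : C) (alpha M : R) :
  q <> RtoC 0 -> 0 < alpha -> Cmod b <= M ->
  ((1 + q * b) * w + RtoC (alpha ^ 2) * q * X
   = Ci * lam * (RtoC (alpha ^ 2) * Y + b * v))%C ->
  Cmod X <= (/ Cmod q + M) / alpha ^ 2 * Cmod w + Cmod lam / Cmod q * Cmod Y
            + Cmod lam * M / (alpha ^ 2 * Cmod q) * Cmod v.
Proof.
  intros Hq Halpha Hb Heq.
  assert (Hq0 := proj1 (Cmod_gt_0 q) Hq).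
  assert (Ha2 := pow_lt alpha 2 Halpha).
  assert (HX : (RtoC (alpha ^ 2) * q * X
    = Ci * lam * (RtoC (alpha ^ 2) * Y + b * v) + - ((1 + q * b) * w))%C)
    by (rewrite <- Heq; ring).
  apply (f_equal Cmod) in HX; rewrite !Cmod_mult, Cmod_R, Rabs_right in HX by lra.
  assert (H1 := Cmod_triangle (Ci * lam * (RtoC (alpha ^ 2) * Y + b * v))%C
                  (- ((1 + q * b) * w))%C).
  rewrite <- HX, Cmod_opp, !Cmod_mult in H1.
  replace (Cmod Ci) with 1 in H1.
  2:{ unfold Cmod, Ci; simpl; replace (0 * (0 * 1) + 1 * (1 * 1)) with 1 by ring.
      symmetry; apply sqrt_1. }
  assert (H2 := Cmod_triangle (RtoC (alpha ^ 2) * Y)%C (b * v)%C).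
  assert (H3 := Cmod_triangle 1%C (q * b)%C).
  rewrite !Cmod_mult, Cmod_R, Rabs_right in H2 by lra; rewrite Cmod_mult, Cmod_1 in H3.
  assert (Hbv := Rmult_le_compat_r _ _ _ (Cmod_ge_0 v) Hb).
  assert (Hqb := Rmult_le_compat_l _ _ _ (Rlt_le _ _ Hq0) Hb).
  assert (H4 : Cmod lam * Cmod (RtoC (alpha ^ 2) * Y + b * v)%C
     <= Cmod lam * (alpha ^ 2 * Cmod Y + M * Cmod v)).
  { apply Rmult_le_compat_l; [apply Cmod_ge_0|lra]. }
  assert (H5 : Cmod (1 + q * b)%C * Cmod w <= (1 + Cmod q * M) * Cmod w).
  { apply Rmult_le_compat_r; [apply Cmod_ge_0|lra]. }
  apply (Rmult_le_reg_l (alpha ^ 2 * Cmod q)); [apply Rmult_lt_0_compat; assumption|].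
  apply (Rle_trans _ (Cmod lam * (alpha ^ 2 * Cmod Y + M * Cmod v)
                      + (1 + Cmod q * M) * Cmod w)); [lra|].
  right; field; split; lra.
Qed.

(** Leibniz' rule for the squared modulus, written as the sum of squares of the components so that
    zeros of [v] cause no trouble. It is applied below with [v_zz] in place of [v]. *)
Lemma is_derive_energy (U : R * R -> Prop) (v : R -> R -> C) (s : R -> R) (r : R) :
  open U -> CkC_on_open_2d 1 U v -> (forall z, 0 <= z <= s r -> U (r, z)) ->
  0 < s r -> ex_derive s r ->
  is_derive (fun x => RInt (fun z => Cmod (v x z) ^ 2) 0 (s x)) r
    (RInt (fun z => 2 * (Re (v r z) * Re (d_r v r z) + Im (v r z) * Im (d_r v r z))) 0 (s r)
     + Cmod (v r (s r)) ^ 2 * Derive s r).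
Proof.
  intros HU [Ha Hb] Hseg Hl Hs.
  assert (Hsq : forall f g : R * R -> R, forall x, continuous f x -> continuous g x ->
    continuous (fun u => f u * g u) x).
  { intros f g x Hf Hg; apply (continuous_mult (K := R_AbsRing) f g x Hf Hg). }
  assert (Ca := fun x z => Ck_on_open_2d_continuous 1 U _ x z Ha).
  assert (Cb := fun x z => Ck_on_open_2d_continuous 1 U _ x z Hb).
  assert (Da := fun x z => Ck_on_open_2d_continuous 0 U _ x z (proj1 (proj2 Ha))).
  assert (Db := fun x z => Ck_on_open_2d_continuous 0 U _ x z (proj1 (proj2 Hb))).
  apply (is_derive_RInt_moving_end U (fun x z => Cmod (v x z) ^ 2)
    (fun r z => 2 * (Re (v r z) * Re (d_r v r z) + Im (v r z) * Im (d_r v r z))));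
    try assumption.
  - intros x z Hxz.
    apply (continuous_ext (fun u : R * R => Re (v (fst u) (snd u)) ^ 2
      + Im (v (fst u) (snd u)) ^ 2)).
    + intros u; symmetry; apply Cmod2_alt.
    + apply (continuous_plus (V := R_NormedModule));
        apply (continuous_comp _ (fun t : R => t ^ 2)); auto;
        apply continuous_sqr, continuous_id.
  - intros x z Hxz.
    apply (is_derive_ext (fun t => Re (v t z) ^ 2 + Im (v t z) ^ 2)).
    + intros t; symmetry; apply Cmod2_alt.
    + assert (Ea := Ck_on_open_2d_is_derive_fst 0 U _ x z Ha Hxz).
      assert (Eb := Ck_on_open_2d_is_derive_fst 0 U _ x z Hb Hxz).
      replace (2 * _) with
        (INR 2 * D_r (fun r z => Re (v r z)) x z * Re (v x z) ^ 1
         + INR 2 * D_r (fun r z => Im (v r z)) x z * Im (v x z) ^ 1)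
        by (unfold d_r, DeriveC, D_r; simpl; ring).
      apply (is_derive_plus (V := R_NormedModule));
        [exact (is_derive_pow _ 2 x _ Ea)|exact (is_derive_pow _ 2 x _ Eb)].
  - intros x z Hxz.
    apply (continuous_scal_r (V := R_NormedModule) 2).
    apply (continuous_plus (V := R_NormedModule)); apply Hsq; auto.
  - apply Derive_correct, Hs.
Qed.

(** Equality on the open interval says nothing about two-sided derivatives at its ends; interior
    equality can be iterated and suffices for integrals. *)
Lemma DeriveC_ext_open (f g : R -> C) (l : R) :
  (forall z, 0 < z < l -> f z = g z) -> forall z, 0 < z < l -> DeriveC f z = DeriveC g z.
Proof.
  intros H z Hz.
  assert (Hl : locally z (fun t => f t = g t)).
  { apply (locally_interval _ z 0 l); [apply Hz|apply Hz|].
    simpl; intros y Hy1 Hy2; apply H; lra. }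
  unfold DeriveC; f_equal; apply Derive_ext_loc; revert Hl; apply filter_imp;
    intros t Ht; now rewrite Ht.
Qed.

Lemma norm_L2_ext (f g : R -> C) (l : R) :
  0 <= l -> (forall z, 0 < z < l -> f z = g z) -> norm_L2 l f = norm_L2 l g.
Proof.
  intros Hl H; unfold norm_L2; f_equal; apply RInt_ext.
  rewrite Rmin_left, Rmax_right by assumption; intros z Hz; now rewrite H.
Qed.

(** The smallness threshold [delta] is chosen from [q] and the bound [M] on [beta] alone, before
    [alpha], [p] and [s]; the constant [c] is chosen before [v0] and [v]. *)
Theorem proposition2p1 :
  forall (q : C) (M : R), q <> RtoC 0 ->
  exists delta : R, 0 < delta /\
  forall (rmax alpha : R) (p : C) (s : R -> R) (beta : R -> R -> C) (smax : R),
    0 < rmax ->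
    0 < alpha ->
    Ck_1d 1 0 rmax s ->
    (forall r, 0 <= r <= rmax -> 0 < s r) ->
    (forall r, 0 <= r <= rmax -> Derive s r <= 0) ->
    Ck_cplx_2d 0 (waveguide rmax s) beta ->
    (forall r z, waveguide rmax s (r, z) -> Cmod (beta r z) <= M) ->
    is_max_on s 0 rmax smax ->
    1 / alpha * smax <= delta ->
    exists c : R,
    forall (v0 : R -> C) (v : R -> R -> C),
      Ck_cplx_1d 2 0 (s 0) v0 ->
      Ck_cplx_2d 3 (waveguide rmax s) v ->
      solves_ibvp rmax alpha p q s beta v0 v ->
      forall r, 0 <= r <= rmax ->
        norm_2 (s r) (v r) <= c * norm_2 (s 0) v0.
Proof.
  intros q M Hq.
  assert (Hq0 := proj1 (Cmod_gt_0 q) Hq).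
  set (A := / Cmod q + Rabs M).
  assert (HA : 0 < A).
  { assert (H1 := Rinv_0_lt_compat _ Hq0); assert (H2 := Rabs_pos M); unfold A; lra. }
  (* With [x = m / alpha <= delta] one gets [4 * x ^ 2 * (A + 1) ^ 2 <= 1], and [A <= (A + 1) ^ 2]
     turns this into the absorption condition [4 * m ^ 2 * k <= 1]. *)
  exists (/ (2 * (A + 1))); split; [apply Rinv_0_lt_compat; lra|].
  intros rmax alpha p s beta m Hrmax Halpha [Us [HUs [Hseg [Hs Hs']]]] Hspos Hsdec _ HM
    [[rm [Hrm Em]] Hsm] Hdelta.
  assert (Ha2 := pow_lt alpha 2 Halpha).
  assert (Hm : 0 < m) by (rewrite <- Em; apply Hspos, Hrm).
  set (k := A / alpha ^ 2).
  set (L := Cmod (lambda alpha p q) / Cmod q).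
  set (N := Cmod (lambda alpha p q) * Rabs M / (alpha ^ 2 * Cmod q)).
  assert (Hk : 0 <= k) by (apply Rlt_le, Rdiv_lt_0_compat; assumption).
  assert (HL : 0 <= L) by (apply Rdiv_le_0_compat; [apply Cmod_ge_0|assumption]).
  assert (HN : 0 <= N).
  { apply Rdiv_le_0_compat; [|apply Rmult_lt_0_compat; assumption].
    apply Rmult_le_pos; [apply Cmod_ge_0|apply Rabs_pos]. }
  assert (Hsmall : 4 * m ^ 2 * k <= 1).
  { set (x := 1 / alpha * m) in *.
    assert (Hx : 0 < x) by (apply Rmult_lt_0_compat; [apply Rdiv_lt_0_compat|]; lra).
    replace (4 * m ^ 2 * k) with (4 * x ^ 2 * A) by (unfold x, k; field; lra).
    assert (H1 : x * (2 * (A + 1)) <= 1).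
    { rewrite <- (Rinv_l (2 * (A + 1))) at 2 by lra.
      apply Rmult_le_compat_r; lra. }
    assert (H2 : (x * (2 * (A + 1))) ^ 2 <= 1 ^ 2).
    { apply pow_incr; split; [apply Rmult_le_pos; lra|assumption]. }
    assert (H3 := pow2_ge_0 x); nra. }
  (* The maximum [S] of [Rabs (Derive s r)] bounds the boundary value [- s' v_z] of [v_r] uniformly
     in [r]. *)
  destruct (continuity_ab_maj (fun r => Rabs (Derive s r)) 0 rmax) as [r1 [Hr1 _]]; [lra| |].
  { intros r Hr; apply continuity_pt_filterlim.
    apply (continuous_comp (Derive s) Rabs); [apply Hs', Hseg, Hr|apply continuous_Rabs]. }
  set (S := Rabs (Derive s r1)) in *.
  assert (HS : 0 <= S) by apply Rabs_pos.
  (* None of the constants depends on [r]: [c1] multiplies the nonlocal term in the bound on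
     [v_zzr], [K] is the growth rate of the energy, and [c0] compares the full norm with [v_zz]. *)
  set (c1 := k * (8 * S + 4 * m * L + 8 * N * m ^ 3) + 2 * N * m).
  assert (Hc1 : 0 <= c1).
  { assert (0 < m ^ 3) by (apply pow_lt, Hm).
    unfold c1; repeat first [lra|apply Rplus_le_le_0_compat|apply Rmult_le_pos]. }
  set (K := 2 * L + 2 * c1 * m).
  assert (HK : 0 <= K).
  { unfold K; repeat first [lra|apply Rplus_le_le_0_compat|apply Rmult_le_pos]. }
  set (c0 := 1 + 4 * m ^ 2 + 4 * m ^ 4).
  assert (Hc0 : 0 <= c0).
  { assert (0 < m ^ 2) by (apply pow_lt, Hm); assert (0 < m ^ 4) by (apply pow_lt, Hm).
    unfold c0; lra. }
  assert (Hc2 : 0 <= c0 * exp (K * rmax)).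
  { apply Rmult_le_pos; [assumption|apply Rlt_le, exp_pos]. }
  (* The estimates concern squared norms, hence the square root. *)
  exists (sqrt (c0 * exp (K * rmax))).
  intros v0 v _ [[Ua [HUa [HDa Hva]]] [Ub [HUb [HDb Hvb]]]] [Heq [Hinit [Hbot Htop]]].
  set (U := fun x => Ua x /\ Ub x).
  assert (HU : open U) by (apply open_and; assumption).
  assert (HD : forall r z, 0 <= r <= rmax -> 0 <= z <= s r -> U (r, z)).
  { intros r z Hr Hz; split; [apply HDa|apply HDb]; split; assumption. }
  assert (Hv : CkC_on_open_2d 3 U v).
  { split; [apply (Ck_on_open_2d_subset 3 Ua)|apply (Ck_on_open_2d_subset 3 Ub)];
      try assumption; intros x Hx; apply Hx. }
  assert (Hv2 : CkC_on_open_2d 2 U v) by (split; apply Ck_on_open_2d_weaken, Hv).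
  assert (Hv1 : CkC_on_open_2d 1 U v) by (split; apply Ck_on_open_2d_weaken, Hv2).
  assert (Hvr : CkC_on_open_2d 2 U (d_r v)) by (split; apply Hv).
  assert (Hvzz : CkC_on_open_2d 1 U (d_z (d_z v))) by (split; apply Hv).
  assert (Hjet : forall r, 0 <= r <= rmax ->
    C2_jet (s r) (v r) (DeriveC (v r)) (DeriveC (DeriveC (v r)))).
  { intros r Hr; apply (CkC_on_open_2d_C2_jet U v r (s r) Hv2).
    intros z Hz; apply HD; assumption. }
  assert (Hsb : forall r, 0 <= r <= rmax -> 0 < s r <= m).
  { intros r Hr; split; [apply Hspos|apply Hsm]; assumption. }
  set (E := fun r => RInt (fun z => Cmod (d_z (d_z v) r z) ^ 2) 0 (s r)).
  assert (HEn : forall r, 0 <= r <= rmax -> norm_L2 (s r) (DeriveC (DeriveC (v r))) ^ 2 = E r).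
  { intros r Hr; apply norm_L2_sqr; [apply Rlt_le, Hspos, Hr|].
    intros z Hz; apply (Hjet r Hr z Hz). }
  assert (HE : forall r, 0 <= r <= rmax -> E r <= E 0 * exp (K * r)).
  { assert (HdE := fun r (Hr : 0 <= r <= rmax) => is_derive_energy U (d_z (d_z v)) s r HU Hvzz
      (fun z => HD r z Hr) (Hspos r Hr) (proj2 (Hs r (Hseg r Hr)))).
    apply (gronwall E _ K rmax HdE).
    intros r Hr.
    assert (Hr' : 0 <= r <= rmax) by lra.
    assert (Hjw := CkC_on_open_2d_C2_jet U (d_r v) r (s r) Hvr (fun z => HD r z Hr')).
    (* The absorption estimate is used with [w = v_r], whose second [z]-derivative is the [v_zzr] of
       the equation. *)
    assert (Hw : forall z, 0 <= z <= s r ->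
      Cmod (d_z (d_z (d_r v)) r z) <= L * Cmod (d_z (d_z v) r z)
        + c1 * RInt (fun z => Cmod (d_z (d_z v) r z)) 0 (s r)).
    { apply (helmholtz_second_derivative_bound (v r) (d_z v r) (d_z (d_z v) r)
        (d_r v r) (d_z (d_r v) r) (d_z (d_z (d_r v)) r) (s r) m S k L N);
        auto.
      - apply (d_r_zero_on_line v 0 rmax); assumption.
      - rewrite (d_r_zero_along_graph U v s 0 rmax r); auto.
        + rewrite Cmod_mult, Cmod_R, Rabs_Ropp.
          apply Rmult_le_compat_r; [apply Cmod_ge_0|apply Hr1, Hr'].
        + apply HD; [assumption|]; assert (H := Hspos r Hr'); lra.
        + apply Hs, Hseg, Hr'.
      - intros z Hz; rewrite (d_z_d_z_d_r U) by auto.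
        apply (equation_bound q (lambda alpha p q) (beta r z)); try assumption.
        + apply (Rle_trans _ M); [apply HM; split; assumption|apply Rle_abs].
        + apply Heq; split; assumption. }
    assert (Hrate : RInt (fun z => 2 * (Re (d_z (d_z v) r z) * Re (d_r (d_z (d_z v)) r z)
        + Im (d_z (d_z v) r z) * Im (d_r (d_z (d_z v)) r z))) 0 (s r) <= K * E r).
    { rewrite (RInt_ext _ (fun z => 2 * (Re (d_z (d_z v) r z) * Re (d_z (d_z (d_r v)) r z)
        + Im (d_z (d_z v) r z) * Im (d_z (d_z (d_r v)) r z))) 0 (s r)).
      - apply (energy_rate_le _ _ (s r) m L c1); auto.
        + intros z Hz; apply (Hjet r Hr' z Hz).
        + intros z Hz; apply (Hjw z Hz).
      - assert (H := Hspos r Hr'); rewrite Rmin_left, Rmax_right by lra.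
        intros z Hz; rewrite (d_z_d_z_d_r U); auto; apply HD; lra. }
    assert (0 <= Cmod (d_z (d_z v) r (s r)) ^ 2 * - Derive s r); [|lra].
    apply Rmult_le_pos; [apply pow2_ge_0|assert (H := Hsdec r Hr'); lra]. }
  intros r Hr.
  assert (H00 : 0 <= 0 <= rmax) by lra.
  (* The initial condition enters here, differentiated twice in [z] at interior points. *)
  assert (HE0 : E 0 <= norm_2 (s 0) v0 ^ 2).
  { rewrite <- HEn, norm_2_sqr by assumption.
    rewrite (norm_L2_ext (DeriveC (DeriveC (v 0))) (DeriveC (DeriveC v0))).
    - assert (H1 := pow2_ge_0 (norm_L2 (s 0) v0)).
      assert (H2 := pow2_ge_0 (norm_L2 (s 0) (DeriveC v0))); lra.
    - apply Rlt_le, Hspos, H00.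
    - do 2 apply DeriveC_ext_open; intros z Hz; apply Hinit; lra. }
  assert (HE0' : 0 <= E 0) by (rewrite <- HEn by assumption; apply pow2_ge_0).
  assert (Hexp : exp (K * r) <= exp (K * rmax)).
  { assert (H : K * r <= K * rmax) by (apply Rmult_le_compat_l; lra).
    destruct H as [H| ->]; [apply Rlt_le, exp_increasing, H|apply Rle_refl]. }
  (* It remains to chain the squares: the norm by [c0 * E r], then [E r] by [E 0] through Gronwall,
     then [E 0] by the norm of [v0]. *)
  apply Rsqr_incr_0_var; [|apply Rmult_le_pos; apply sqrt_pos].
  rewrite Rsqr_mult, Rsqr_sqrt, !Rsqr_pow2 by assumption.
  apply (Rle_trans _ (c0 * E r)).
  { rewrite <- HEn by assumption.
    apply norm_2_sqr_le_of_dirichlet; auto. }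
  rewrite Rmult_assoc; apply Rmult_le_compat_l; [assumption|].
  apply (Rle_trans _ _ _ (HE r Hr)).
  rewrite Rmult_comm; apply Rmult_le_compat; try assumption; apply Rlt_le, exp_pos.
Qed.
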